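(* If $\mathcal{C}=\Omega$ or $\mathcal{C}=\Omega_{\ast1}$, then $\mathbf{I}(\mathcal{C})$ is a three-element chain (with respect to inclusion): $\mathbf{I}(\mathcal{C})=\{\mathcal{C},\mathcal{C}_{=},\mathcal{C}\cap\mathcal{R}\}$.
   Context: $\Omega$ is the set of all Boolean functions $f\colon\{0,1\}^n\to\{0,1\}$, $n\ge 1$. An $m$-ary $g$ is a subfunction of an $n$-ary $f$ if there is a map $\sigma\colon\{1,\dots,n\}\to\{1,\dots,m\}$ with $g(x_1,\dots,x_m)=f(x_{\sigma(1)},\dots,x_{\sigma(n)})$ identically. An equational class is a set $\mathcal{K}\subseteq\Omega$ (possibly empty) such that every subfunction of a member of $\mathcal{K}$ is in $\mathcal{K}$. For an $n$-ary $f$ and $k$-ary $g_1,\dots,g_n$, the composition $f(g_1,\dots,g_n)$ is the $k$-ary function $\mathbf{a}\mapsto f(g_1(\mathbf{a}),\dots,g_n(\mathbf{a}))$; $\mathcal{K}$ is composition-closed if all compositions $f(g_1,\dots,g_n)$ with $f,g_1,\dots,g_n\in\mathcal{K}$ ($g_i$ of equal arity) belong to $\mathcal{K}$. A clone is a composition-closed subset of $\Omega$ containing all projections; $[\mathcal{K}]$ is the smallest clone containing $\mathcal{K}$. $\mathbf{I}$ is the set of all composition-closed equational classes, and $\mathbf{I}(\mathcal{C})=\{\mathcal{K}\in\mathbf{I}:[\mathcal{K}]=\mathcal{C}\}$. $\Omega_{\ast1}=\{f\in\Omega:f(1,\dots,1)=1\}$; $\Omega_{=}=\{f\in\Omega:f(0,\dots,0)=f(1,\dots,1)\}$;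 $\mathcal{C}_{=}=\mathcal{C}\cap\Omega_{=}$. $\mathcal{R}=\{f\in\Omega:f(\lnot x_1,\dots,\lnot x_n)=f(x_1,\dots,x_n)\text{ for all }x_1,\dots,x_n\}$ is the class of reflexive functions. *)

(* Defs.v *)
From mathcomp Require Export all_boot.
From mathcomp Require Export boolp classical_sets functions cardinality.

Set Implicit Arguments.
Unset Strict Implicit.
Unset Printing Implicit Defensive.

Local Open Scope classical_set_scope.

Definition nbfun (n : nat) : Type := ('I_n -> bool) -> bool.

(* Arities are at least 1, so a function is stored with the predecessor of its
   arity. *)
Record boolfun := BoolFun { arity_pred : nat; eval :> ('I_arity_pred.+1 -> bool) -> bool }.

Definition arity (f : boolfun) : nat := (arity_pred f).+1.

Definition Omega : set boolfun := setT.

(* Variables are indexed from 0 instead of 1. *)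
Definition subfunction (g f : boolfun) : Prop :=
  exists sigma : 'I_(arity f) -> 'I_(arity g),
    forall x : 'I_(arity g) -> bool, g x = f (fun i => x (sigma i)).

Definition equational_class (K : set boolfun) : Prop :=
  forall f g : boolfun, K f -> subfunction g f -> K g.

Definition composition n k (f : nbfun n) (g : 'I_n -> nbfun k) : nbfun k :=
  fun a => f (fun i => g i a).

Definition composition_closed (K : set boolfun) : Prop :=
  forall n k (f : nbfun n.+1) (g : 'I_n.+1 -> nbfun k.+1),
    K (BoolFun f) -> (forall i, K (BoolFun (g i))) ->
    K (BoolFun (composition f g)).

Definition projection n (i : 'I_n) : nbfun n := fun a => a i.

Definition clone (C : set boolfun) : Prop :=
  composition_closed C /\
  forall n (i : 'I_n.+1), C (BoolFun (projection i)).

Definition clone_generated (K : set boolfun) : set boolfun := smallest clone K.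

Definition closed_classes : set (set boolfun) :=
  [set K | equational_class K /\ composition_closed K].

Definition closed_classes_of (C : set boolfun) : set (set boolfun) :=
  [set K | closed_classes K /\ clone_generated K = C].

Definition Omega_s1 : set boolfun := [set f : boolfun | f (fun=> true) = true].

Definition Omega_eq : set boolfun := [set f : boolfun | f (fun=> false) = f (fun=> true)].

Definition reflexive_functions : set boolfun :=
  [set f : boolfun | forall x : 'I_(arity f) -> bool, f (fun i => ~~ x i) = f x].

(* Main.v *)
Require Import Defs.
From mathcomp Require Import all_boot.
From mathcomp Require Import boolp classical_sets functions cardinality.

(** Write [C] for [Omega] or [Omega_s1], and let [K] be a composition-closed
    equational class that generates the clone [C].

    The functions [p] such that [p(u_1, ..., u_m)] lies in [K] whenever all the
    [u_i] do form a clone, and this clone contains [K] because [K] is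
    composition-closed; so it contains [C], and [K] absorbs outer composition
    by every member of [C] ([generated_clone_absorbs]). Consequently membership
    in [K] is a matter of separating points ([separated_in_class]): if [f] in
    [C] takes equal values at any two points that are not separated by a finite
    family [u] of members of [K], then [f = p(u)] for some [p] in [C], and [f]
    is in [K].

    It remains to see which points [K] separates, using only minors
    [f(x_i, x_j)] of a well-chosen [f] in [K], each variable of [f] being
    replaced by one of two.
    - If some [f] in [K] has [f(0,...,0) <> f(1,...,1)], the minors
      [f(x_i, ..., x_i)] are literals, separate all points, and [K = C].
    - Otherwise [K] lies in [Omega_eq]. If some [f] in [K] is not reflexive, it
      has a binary minor [g] that is, up to negation, the conjunction of [x] and
      not [y]; the functions [g(x_i, x_j)] separate everything except the two
      constant points from each other, and [K] is [C] cut with [Omega_eq].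
    - If [K] consists of reflexive functions, one of them is nonconstant, for
      constants only generate monotone functions, whereas [C] contains the
      implication. It has a binary minor which is, up to negation, [x + y], and
      the functions [g(x_i, x_j)] separate everything except complementary
      points, so [K] is the class of all reflexive members of [C].

    Conversely, each of the three classes generates [C], because the smallest
    one does ([reflexive_generates]): [f(x) = F(x, 1)] for the reflexive
    function [F(x, t) = f(x_1 <-> t, ..., x_n <-> t)], and both [F] and the
    constant 1 are reflexive members of [C]. *)

Local Open Scope classical_set_scope.
Local Open Scope card_scope.

(** * Clones and absorption *)

Lemma subfunction_minor (K : set boolfun) n m (f : nbfun n.+1)
    (s : 'I_n.+1 -> 'I_m.+1) :
  equational_class K -> K (BoolFun f) ->
  K (BoolFun (fun x : 'I_m.+1 -> bool => f (fun i => x (s i)))).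
Proof. by move=> eqK Kf; apply: (eqK _ _ Kf); exists s. Qed.

(** The members of the generated clone act on [K] from the outside: the
    functions that do so form a clone containing [K]. *)
Lemma generated_clone_absorbs (K : set boolfun) m k (p : nbfun m.+1)
    (u : 'I_m.+1 -> nbfun k.+1) :
  composition_closed K -> clone_generated K (BoolFun p) ->
  (forall i, K (BoolFun (u i))) -> K (BoolFun (composition p u)).
Proof.
move=> compK Cp Ku.
pose P := [set q : boolfun | forall k' (v : 'I_(arity q) -> nbfun k'.+1),
  (forall i, K (BoolFun (v i))) -> K (BoolFun (composition q v))].
suff /(_ _ Cp) Pp : clone_generated K `<=` P by exact: Pp.
apply: smallest_sub; first split.
- move=> n l f g Pf Pg k' v Kv.
  by apply: (Pf k' (fun i => composition (g i) v)) => i; apply: Pg.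
- by move=> n i k' v; apply.
- by case=> n f Kf k' v Kv; apply: compK.
Qed.

Lemma clone_generated_incl (K : set boolfun) : K `<=` clone_generated K.
Proof. exact: sub_gen_smallest. Qed.

Definition monotone : set boolfun := [set f : boolfun |
  forall x y : 'I_(arity f) -> bool, (forall i, x i ==> y i) -> f x ==> f y].

Lemma monotone_clone : clone monotone.
Proof.
split=> [n k f g mf mg x y lexy | n i x y]; last exact.
by apply: mf => i; apply: mg.
Qed.

(** * The two clones *)

Section TwoClones.

Variable C : set boolfun.
Hypothesis hC : C = Omega \/ C = Omega_s1.

Lemma two_clones_clone : clone C.
Proof.
case: hC => ->; first by [].
split=> [n k f g Cf Cg | n i]; last by [].
rewrite /Omega_s1 /= /composition -[RHS]Cf /=; congr f.
by apply: funext => i; exact: Cg.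
Qed.

Lemma two_clones_equational : equational_class C.
Proof.
by case: hC => -> // f g fC [s fs]; rewrite /Omega_s1 /= fs; apply: fC.
Qed.

Lemma two_clones_sub : Omega_s1 `<=` C.
Proof. by case: hC => ->. Qed.

Definition implication : boolfun :=
  @BoolFun 1 (fun a => a ord0 ==> a ord_max).

Lemma implication_in : C implication.
Proof. exact: two_clones_sub. Qed.

Lemma implication_not_monotone : ~ monotone implication.
Proof.
move=> /(_ (fun=> false) (fun i => i == ord0)) /=.
by move=> /(_ (fun=> isT)).
Qed.

(** * Membership by separation of points *)

(** The outer function [p] needed for [f = p(u)] is prescribed only on the
    range of [u]. Being true elsewhere, it preserves 1 as soon as [f] and
    all the [u t] do. *)
Lemma separated_in_class (K : set boolfun) (T : finType) (t0 : T) k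
    (u : T -> nbfun k.+1) (f : nbfun k.+1) :
  closed_classes_of C K -> (forall t, K (BoolFun (u t))) -> C (BoolFun f) ->
  (forall a b, (forall t, u t a = u t b) -> f a = f b) ->
  K (BoolFun f).
Proof.
move=> [[eqK compK] genK] Ku Cf sepf.
(* The type T is listed with an arity that is visibly positive. *)
have cardT : #|T|.-1.+1 = #|T| by rewrite prednK //; apply/card_gt0P; exists t0.
pose v (i : 'I_#|T|.-1.+1) := u (nth t0 (enum T) i).
pose p : nbfun #|T|.-1.+1 :=
  fun b => `[< forall a, (forall i, v i a = b i) -> f a >].
have v_onto t : exists i, v i = u t.
  have lt_t : index t (enum T) < #|T|.-1.+1.
    by rewrite cardT cardE index_mem mem_enum.
  by exists (Ordinal lt_t); rewrite /v /= nth_index ?mem_enum.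
have -> : f = composition p v.
  apply: funext => a; apply/idP/asboolP => [fa b vab | ]; last exact.
  by rewrite (sepf b a) // => t; have [i <-] := v_onto t; apply: vab.
apply: generated_clone_absorbs => // [|i]; last exact: Ku.
rewrite genK.
case: hC => C_def; first by rewrite C_def.
have KC g : K g -> g (fun=> true) = true.
  move=> Kg; have : C g by rewrite -genK; apply: clone_generated_incl.
  by rewrite C_def.
rewrite C_def /Omega_s1 /=; apply/asboolP => a va.
move: Cf; rewrite C_def /Omega_s1 /= => f1.
rewrite (sepf a (fun=> true)) // => t.
have [i <-] := v_onto t; rewrite va.
exact/esym/(KC _ (Ku _)).
Qed.

(** * Binary minors *)

(** [two_block f b p q] is the value at [(p, q)] of the binary minor of [f]
    that identifies all the variables where [b] is true, and all the others. *)
Definition two_block n (f : nbfun n.+1) (b : 'I_n.+1 -> bool) (p q : bool) :=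
  f (fun i => if b i then p else q).

Lemma two_block_same n (f : nbfun n.+1) b p : two_block n f b p p = f (fun=> p).
Proof. by congr f; apply: funext => i; case: ifP. Qed.

Lemma two_block_tf n (f : nbfun n.+1) b : two_block n f b true false = f b.
Proof. by congr f; apply: funext => i; case: ifP. Qed.

Lemma two_block_ft n (f : nbfun n.+1) b :
  two_block n f b false true = f (fun i => ~~ b i).
Proof. by congr f; apply: funext => i; case: ifP. Qed.

Lemma two_block_separated (K : set boolfun) n m (f : nbfun n.+1) b
    (g : nbfun m.+1) :
  closed_classes_of C K -> K (BoolFun f) -> C (BoolFun g) ->
  (forall x y : 'I_m.+1 -> bool,
     (forall i j, two_block n f b (x i) (x j) = two_block n f b (y i) (y j)) ->
     g x = g y) ->
  K (BoolFun g).
Proof.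
move=> IK Kf Cg sepg.
pose u (ij : 'I_m.+1 * 'I_m.+1) : nbfun m.+1 :=
  fun x => two_block n f b (x ij.1) (x ij.2).
apply: (separated_in_class K _ (ord0, ord0) m u) => // [[i j]|x y uxy].
- have [[eqK _] _] := IK.
  have := subfunction_minor K _ _ f (fun l => if b l then i else j) eqK Kf.
  congr (K (BoolFun _)); apply: funext => x.
  by congr f; apply: funext => l; case: ifP.
- by apply: sepg => i j; apply: (uxy (i, j)).
Qed.

(** If [x] takes both values, fixing [j] with [x j] false forces [y j] to be
    false too, and the products then read off [x] and [y] entirely. Constant
    points give the zero product everywhere, so nothing can tell them apart. *)
Lemma andN_separation n (x y : 'I_n.+1 -> bool) :
  (forall i j, x i && ~~ x j = y i && ~~ y j) ->
  x = y \/ exists p q, x = (fun=> p) /\ y = (fun=> q).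
Proof.
move=> xy; have [[i [j xij]] | constx] := pselect (exists i j, x i && ~~ x j).
  left; apply: funext => k; have := xy k j; have := xy i j.
  by rewrite xij => /esym/andP[_ ->]; case/andP: xij => _ ->; rewrite !andbT.
right; exists (x ord0), (y ord0).
have half (z : 'I_n.+1 -> bool) : (forall i j, ~~ (z i && ~~ z j)) ->
    z = (fun=> z ord0).
  move=> zz; apply: funext => i; have := zz i ord0; have := zz ord0 i.
  by case: (z i); case: (z ord0).
split; apply: half => i j; first by apply/negP => xij; apply: constx; exists i, j.
by rewrite -xy; apply/negP => xij; apply: constx; exists i, j.
Qed.

Lemma addb_separation n (x y : 'I_n.+1 -> bool) :
  (forall i j, x i (+) x j = y i (+) y j) ->
  x = y \/ x = (fun i => ~~ y i).
Proof.
move=> xy; case: (eqVneq (x ord0) (y ord0)) => [xy0 | nxy0]; [left | right].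
all: apply: funext => i; have := xy i ord0.
  by rewrite xy0; apply: addIb.
by move: nxy0; case: (x i); case: (y i); case: (x ord0); case: (y ord0).
Qed.

(** * The classes that generate the clone *)

Lemma class_not_eq (K : set boolfun) :
  closed_classes_of C K -> ~ (K `<=` Omega_eq) -> K = C.
Proof.
move=> IK; have [_ genK] := IK => nKeq.
apply/seteqP; split; first by rewrite -genK; apply: clone_generated_incl.
have [f [Kf nf]] : exists f, K f /\ ~ Omega_eq f.
  by apply: contrapT => nex; apply: nKeq => f Kf; apply: contrapT => nf;
     apply: nex; exists f.
case: f Kf nf => n f Kf nf [m g] Cg.
(* The diagonal minors f(x_i, ..., x_i) already separate all points. *)
apply: (two_block_separated K n m f (fun=> true)) => // x y xy.
congr g; apply: funext => i; have := xy i i; rewrite !two_block_same.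
move: nf; rewrite /Omega_eq /=.
by case: (x i); case: (y i) => // nf fxy; case: nf.
Qed.

Lemma class_not_reflexive (K : set boolfun) :
  closed_classes_of C K -> K `<=` Omega_eq -> ~ (K `<=` reflexive_functions) ->
  K = C `&` Omega_eq.
Proof.
move=> IK Keq nKr; have [_ genK] := IK.
apply/seteqP; split=> [f Kf | [m g] [Cg g01]].
  by split; [rewrite -genK; apply: clone_generated_incl | apply: Keq].
have [f [Kf nf]] : exists f, K f /\ ~ reflexive_functions f.
  by apply: contrapT => nex; apply: nKr => f Kf; apply: contrapT => nf;
     apply: nex; exists f.
case: f Kf nf => n f Kf nf.
have f01 : f (fun=> false) = f (fun=> true) := Keq _ Kf.
(* Of two complementary points where f differs, b is the one where the value
   is not the one taken at the constant points. *)
have [b fb fNb] : exists2 b, f b = ~~ f (fun=> true) &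
    f (fun i => ~~ b i) = f (fun=> true).
  have [b nfb] : exists b, f (fun i => ~~ b i) <> f b.
    by apply: contrapT => nex; apply: nf => b; apply: contrapT => nfb;
       apply: nex; exists b.
  have NNb : (fun i => ~~ ~~ b i) = b by apply: funext => i; rewrite negbK.
  have [fb1 | fb1] := eqVneq (f b) (f (fun=> true)).
    exists (fun i => ~~ b i); last by rewrite NNb.
    by move: nfb; rewrite fb1; case: (f _); case: (f _).
  by exists b; move: nfb fb1; case: (f b); case: (f _); case: (f _).
have fE p q : two_block n f b p q = f (fun=> true) (+) (p && ~~ q).
  case: p q => [] [].
  - by rewrite two_block_same addbF.
  - by rewrite two_block_tf fb addbT.
  - by rewrite two_block_ft fNb addbF.
  - by rewrite two_block_same addbF.
apply: (two_block_separated K n m f b) => // x y xy.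
have : forall i j, x i && ~~ x j = y i && ~~ y j.
  by move=> i j; have := xy i j; rewrite !fE; apply: addbI.
case/andN_separation => [-> // | [p [q [-> ->]]]].
by move: g01; rewrite /Omega_eq /=; case: p; case: q.
Qed.

Lemma class_nonconstant (K : set boolfun) :
  closed_classes_of C K ->
  exists f : boolfun, K f /\ exists b, f b <> f (fun=> true).
Proof.
move=> [_ genK]; apply: contrapT => constK; apply: implication_not_monotone.
have : C implication := implication_in.
rewrite -genK; apply: smallest_sub => [|f Kf x y _]; first exact: monotone_clone.
have fconst z : f z = f (fun=> true).
  by apply: contrapT => nfz; apply: constK; exists f; split=> //; exists z.
by rewrite (fconst x) (fconst y) implybb.
Qed.

Lemma class_reflexive (K : set boolfun) :
  closed_classes_of C K -> K `<=` reflexive_functions ->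
  K = C `&` reflexive_functions.
Proof.
move=> IK Kr; have [_ genK] := IK.
apply/seteqP; split=> [f Kf | [m g] [Cg gr]].
  by split; [rewrite -genK; apply: clone_generated_incl | apply: Kr].
have [[n f] [Kf [b nfb]]] := class_nonconstant K IK.
have fr : forall x, f (fun i => ~~ x i) = f x := Kr _ Kf.
have {nfb}fb : f b = ~~ f (fun=> true).
  by move: nfb => /=; case: (f b); case: (f _).
have fE p q : two_block n f b p q = f (fun=> true) (+) (p (+) q).
  case: p q => [] [].
  - by rewrite two_block_same addbF.
  - by rewrite two_block_tf fb addbT.
  - by rewrite two_block_ft fr fb /= addbT.
  - by rewrite two_block_same /= addbF; apply: (fr (fun=> true)).
apply: (two_block_separated K n m f b) => // x y xy.
have : forall i j, x i (+) x j = y i (+) y j.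
  by move=> i j; have := xy i j; rewrite !fE; apply: addbI.
by case/addb_separation => [-> // | ->]; apply: gr.
Qed.

(** * The three classes generate the clone *)

Lemma reflexive_sub_eq : reflexive_functions `<=` Omega_eq.
Proof. by move=> f fr; apply: (fr (fun=> true)). Qed.

Lemma Omega_eq_equational : equational_class Omega_eq.
Proof. by move=> f g f01 [s fs]; rewrite /Omega_eq /= !fs. Qed.

Lemma reflexive_equational : equational_class reflexive_functions.
Proof. by move=> f g fr [s fs] x; rewrite !fs; apply: (fr (fun i => x (s i))). Qed.

Lemma Omega_eq_comp : composition_closed Omega_eq.
Proof.
move=> n k f g _ g01; rewrite /Omega_eq /= /composition.
by congr f; apply: funext => i; exact: g01.
Qed.

Lemma reflexive_comp : composition_closed reflexive_functions.
Proof.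
move=> n k f g _ gr x; rewrite /= /composition.
by congr f; apply: funext => i; exact: gr.
Qed.

Lemma closed_classes_setI (K L : set boolfun) :
  closed_classes K -> closed_classes L -> closed_classes (K `&` L).
Proof.
move=> [eqK cK] [eqL cL]; split.
  by move=> f g [Kf Lf] fg; split; [apply: eqK fg | apply: eqL fg].
move=> n k f g [Kf Lf] KLg.
by split; [apply: cK | apply: cL] => // i; case: (KLg i).
Qed.

(** Adding one variable [t], at index [ord_max], turns [f] into the reflexive
    function [f(x_1 <-> t, ..., x_n <-> t)]; the constant 1 substituted for
    [t] gives [f] back. *)
Lemma reflexive_generates (D : set boolfun) :
  clone D -> C `&` reflexive_functions `<=` D -> C `<=` D.
Proof.
move=> [compD projD] RD [n f] Cf.
pose F : nbfun n.+2 := fun x => f (fun i => x (lift ord_max i) == x ord_max).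
have DF : D (BoolFun F).
  apply: RD; split.
  - case: hC Cf => ->; first by [].
    by rewrite /Omega_s1 /= /F => f1; rewrite -[RHS]f1.
  - move=> x; rewrite /= /F; congr f; apply: funext => i.
    by case: (x _); case: (x _).
have D1 : D (@BoolFun n (fun=> true)) by apply: RD; split=> //; apply: two_clones_sub.
pose g (i : 'I_n.+2) : nbfun n.+1 :=
  if unlift ord_max i is Some j then @projection n.+1 j else fun=> true.
have -> : f = composition F g.
  apply: funext => x; rewrite /composition /F; congr f; apply: funext => i.
  by rewrite /g liftK unlift_none /projection eqb_id.
apply: compD => // i; rewrite /g; case: (unlift _ _) => [j|]; last exact: D1.
exact: projD.
Qed.

Lemma closed_classes_of_between (K : set boolfun) :
  closed_classes K -> C `&` reflexive_functions `<=` K -> K `<=` C ->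
  closed_classes_of C K.
Proof.
move=> IK RK KC; split=> //; apply/seteqP; split.
  by apply: smallest_sub => //; apply: two_clones_clone.
by move=> f Cf D [cD KD]; apply: reflexive_generates Cf => // h /RK; apply: KD.
Qed.

Lemma closed_classes_of_three :
  closed_classes_of C = [set C; C `&` Omega_eq; C `&` reflexive_functions].
Proof.
have IC : closed_classes C.
  by split; [apply: two_clones_equational | case: two_clones_clone].
apply/seteqP; split=> [K IK | K [[|]|] ->].
- have [Keq | /(class_not_eq K IK)] := pselect (K `<=` Omega_eq); last by left; left.
  have [Kr | nKr] := pselect (K `<=` reflexive_functions).
    by right; apply: class_reflexive.
  by left; right; apply: class_not_reflexive.
- by apply: closed_classes_of_between => // f [].
- apply: closed_classes_of_between => [| f [Cf /reflexive_sub_eq] | f []] //.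
  by apply: closed_classes_setI => //; split;
     [apply: Omega_eq_equational | apply: Omega_eq_comp].
- apply: closed_classes_of_between => [| | f []] //.
  by apply: closed_classes_setI => //; split;
     [apply: reflexive_equational | apply: reflexive_comp].
Qed.

Lemma clone_neq_eq : C <> C `&` Omega_eq.
Proof.
have [_ /(_ 0 ord0) Cid] := two_clones_clone.
by move=> CE; move: Cid; rewrite CE => -[].
Qed.

Lemma eq_neq_reflexive : C `&` Omega_eq <> C `&` reflexive_functions.
Proof.
move=> E; have : (C `&` Omega_eq) implication.
  by split; first exact: implication_in.
by rewrite E => -[_ /(_ (fun i => i == ord0))].
Qed.

End TwoClones.

Lemma chain3_card_total (T : Type) (A B D : set T) :
  B `<=` A -> D `<=` B -> A <> B -> B <> D ->
  [set A; B; D] #= `I_3 /\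
  total_on [set A; B; D] (fun K L : set T => K `<=` L).
Proof.
move=> BA DB nAB nBD.
have DA : D `<=` A by move=> x /DB /BA.
have nAD : A <> D by move=> AD; apply: nAB; apply/seteqP; split; rewrite // AD.
split; last first.
  move=> K L [[|]|] -> [[|]|] ->; solve [by left | by right].
rewrite card_eq_sym; apply/card_set_bijP; exists (nth A [:: A; B; D]).
split.
- by move=> [|[|[|]]] //= _; [left; left | left; right | right].
- move=> i j; rewrite !inE /=.
  by case: i => [|[|[|]]] //; case: j => [|[|[|]]] //= _ _ E;
    by [case: nAB | case: nBD | case: nAD].
- by move=> K [[|]|] ->; [exists 0 | exists 1 | exists 2].
Qed.

Theorem theorem4p3 (C : set boolfun) (hC : C = Omega \/ C = Omega_s1) :
  [/\ closed_classes_of C =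
        [set C; C `&` Omega_eq; C `&` reflexive_functions],
      closed_classes_of C #= `I_3
    & total_on (closed_classes_of C) (fun K L : set boolfun => K `<=` L)].
Proof.
have E := closed_classes_of_three C hC.
have [|||| card tot] :=
  chain3_card_total boolfun C (C `&` Omega_eq) (C `&` reflexive_functions).
- by move=> f [].
- by move=> f [Cf /reflexive_sub_eq].
- exact: clone_neq_eq.
- exact: eq_neq_reflexive.
- by rewrite E.
Qed.
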